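(* For every $n\ge0$, $$\gcd(a_n,b_n,c_n,d_n,e_n,t_n)=1 .$$ Consequently the identity $a_n^3+b_n^3+c_n^3+d_n^3+e_n^3=t_n^3+(-1)^{n+1}$ (valid for all $n\ge 0$) gives infinitely many primitive positive integer solutions $(x_1,\dots,x_5,t)$ for each of the equations $$x_1^3+x_2^3+x_3^3+x_4^3+x_5^3=t^3+1\qquad\text{and}\qquad x_1^3+x_2^3+x_3^3+x_4^3+x_5^3=t^3-1 .$$
   Context: Let $r_0=1,\ r_1=-5,\ r_{n+2}=16r_{n+1}+r_n$ and $s_0=0,\ s_1=2,\ s_{n+2}=16s_{n+1}+s_n$. For $n\ge0$ put $a_n=r_n^2-13r_ns_n+26s_n^2$, $b_n=6r_n^2+182s_n^2$, $c_n=7r_n^2+156s_n^2$, $d_n=167r_n^2+4342s_n^2$, $e_n=326r_n^2+8476s_n^2$, $t_n=340r_n^2+8840s_n^2$. A solution $(x_1,\dots,x_5,t)$ is primitive if $\gcd(x_1,\dots,x_5,t)=1$. *)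

(* Defs.v *)
From mathcomp Require Import all_boot all_order all_algebra.
From mathcomp Require Import classical_sets cardinality.

Set Implicit Arguments.
Unset Strict Implicit.
Unset Printing Implicit Defensive.

Import GRing.Theory.
Local Open Scope ring_scope.
Local Open Scope classical_set_scope.

Fixpoint r_ (n : nat) : int :=
  match n with
  | 0 => 1
  | 1 => - 5
  | (m.+1 as k).+1 => 16 * r_ k + r_ m
  end.

Fixpoint s_ (n : nat) : int :=
  match n with
  | 0 => 0
  | 1 => 2
  | (m.+1 as k).+1 => 16 * s_ k + s_ m
  end.

Definition a_ (n : nat) : int := r_ n ^+ 2 - 13 * r_ n * s_ n + 26 * s_ n ^+ 2.
Definition b_ (n : nat) : int := 6 * r_ n ^+ 2 + 182 * s_ n ^+ 2.
Definition c_ (n : nat) : int := 7 * r_ n ^+ 2 + 156 * s_ n ^+ 2.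
Definition d_ (n : nat) : int := 167 * r_ n ^+ 2 + 4342 * s_ n ^+ 2.
Definition e_ (n : nat) : int := 326 * r_ n ^+ 2 + 8476 * s_ n ^+ 2.
Definition t_ (n : nat) : int := 340 * r_ n ^+ 2 + 8840 * s_ n ^+ 2.

(* A candidate solution (x_1, x_2, x_3, x_4, x_5, t). *)
Definition sextuple : Type := (int * int * int * int * int * int)%type.

Definition abcdet (n : nat) : sextuple := (a_ n, b_ n, c_ n, d_ n, e_ n, t_ n).

Definition gcd6 (x : sextuple) : int :=
  let: (x1, x2, x3, x4, x5, y) := x in
  gcdz x1 (gcdz x2 (gcdz x3 (gcdz x4 (gcdz x5 y)))).

Definition positive_sextuple (x : sextuple) : Prop :=
  let: (x1, x2, x3, x4, x5, y) := x in
  [/\ 0 < x1, 0 < x2 & 0 < x3] /\ [/\ 0 < x4, 0 < x5 & 0 < y].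

Definition primitive_sextuple (x : sextuple) : Prop := gcd6 x = 1.

Definition solves (k : int) (x : sextuple) : Prop :=
  let: (x1, x2, x3, x4, x5, y) := x in
  x1 ^+ 3 + x2 ^+ 3 + x3 ^+ 3 + x4 ^+ 3 + x5 ^+ 3 = y ^+ 3 + k.

Definition primitive_positive_solutions (k : int) : set sextuple :=
  [set x | [/\ solves k x, positive_sextuple x & primitive_sextuple x]].

(* Main.v *)
Require Import Defs.
From mathcomp Require Import all_boot all_order all_algebra.
From mathcomp Require Import classical_sets cardinality.
From mathcomp Require Import ring zify.

(** The pair [(r_n, s_n)] is the orbit of [(1, 0)] under an integer matrix of
    trace 16 and determinant -1, so the quadratic form
    [Q = r^2 + 13 r s + 26 s^2], which the matrix multiplies by -1, takes the
    value [(-1)^n] at step [n]: this is a Pell-type equation for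
    [8 + sqrt 65].  As polynomials in [r] and [s],
    [a^3 + b^3 + c^3 + d^3 + e^3 = t^3 - Q^3], and the cubic identity is the
    value of this one along the orbit ([cubic_identity]).

    Primitivity is then free: a common divisor of the six terms divides
    [a^3 + b^3 + c^3 + d^3 + e^3 - t^3], which is a unit.

    Positivity is immediate except for [a_n], where it holds because
    [r_n <> 0] and [r_n s_n <= 0].  Finally [7 b - 6 c = 338 s^2], so a sextuple
    determines [s_n >= 0], and [n] with it since [s] is strictly increasing;
    the even indices and the odd indices therefore give infinitely many
    solutions each. *)

Import Order.TTheory GRing.Theory Num.Theory.

Local Open Scope ring_scope.
Local Open Scope classical_set_scope.

(** * The orbit and its invariant form *)

Lemma r_rec n : r_ n.+2 = 16 * r_ n.+1 + r_ n.
Proof. by []. Qed.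

Lemma s_rec n : s_ n.+2 = 16 * s_ n.+1 + s_ n.
Proof. by []. Qed.

(** The two second-order recurrences are one first-order system: the matrix
    below sends [(1, 0)] to [(-5, 2)] and satisfies [M^2 = 16 M + 1]. *)
Lemma rs_step n :
  r_ n.+1 = - 5 * r_ n - 52 * s_ n /\ s_ n.+1 = 2 * r_ n + 21 * s_ n.
Proof.
elim: n => [|n [IHr IHs]]; first by [].
rewrite r_rec s_rec; lia.
Qed.

Lemma pell_form n : r_ n ^+ 2 + 13 * r_ n * s_ n + 26 * s_ n ^+ 2 = (-1) ^+ n.
Proof.
elim: n => [|n IHn]; first by [].
have [-> ->] := rs_step n.
by rewrite [RHS]exprS -IHn; ring.
Qed.

Lemma cubic_identity n :
  a_ n ^+ 3 + b_ n ^+ 3 + c_ n ^+ 3 + d_ n ^+ 3 + e_ n ^+ 3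
  = t_ n ^+ 3 + (-1) ^+ n.+1.
Proof.
(* The sign is its own cube, so it may be written as the cube of the form. *)
have -> : (-1) ^+ n.+1 = - ((-1) ^+ n) ^+ 3 :> int.
  by rewrite exprS mulN1r exprAC -[3%N]/(1 + 2)%N exprD sqrrN expr1n mulr1.
by rewrite -pell_form /a_ /b_ /c_ /d_ /e_ /t_; ring.
Qed.

(** * Primitivity *)

Lemma gcd6_eq1_of_cubes (x1 x2 x3 x4 x5 y : int) (n : nat) :
  x1 ^+ 3 + x2 ^+ 3 + x3 ^+ 3 + x4 ^+ 3 + x5 ^+ 3 = y ^+ 3 + (-1) ^+ n ->
  gcdz x1 (gcdz x2 (gcdz x3 (gcdz x4 (gcdz x5 y)))) = 1.
Proof.
set g := gcdz _ _ => cubes.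
have : (g %| g)%Z by exact: dvdzz.
rewrite {2}/g !dvdz_gcd => /and5P[g1 g2 g3 g4 /andP[g5 gy]].
have cube x : (g %| x)%Z -> (g %| x ^+ 3)%Z by move=> gx; rewrite exprS dvdz_mulr.
have : (g %| (-1) ^+ n)%Z.
  have -> : (-1) ^+ n
    = x1 ^+ 3 + x2 ^+ 3 + x3 ^+ 3 + x4 ^+ 3 + x5 ^+ 3 - y ^+ 3 :> int.
    by rewrite cubes addrAC subrr add0r.
  by rewrite rpredB ?rpredD //; apply: cube.
by rewrite dvdzE abszX /= exp1n dvdn1 /g /gcdz absz_nat => /eqP->.
Qed.

(** * Signs and growth *)

Lemma s_ge0_lt n : 0 <= s_ n /\ s_ n < s_ n.+1.
Proof.
elim: n => [|n [s0 lts]]; first by [].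
by rewrite s_rec; lia.
Qed.

Lemma r_succ_lt0 n : r_ n.+1 < 0 /\ r_ n.+2 < 0.
Proof.
elim: n => [|n [r1 r2]]; first by [].
by split=> //; rewrite r_rec; lia.
Qed.

Lemma r_neq0 n : r_ n != 0.
Proof. by case: n => // n; have [/ltr0_neq0] := r_succ_lt0 n. Qed.

Lemma rs_le0 n : r_ n * s_ n <= 0.
Proof.
case: n => [//|n]; apply: mulr_le0_ge0.
  by have [/ltW] := r_succ_lt0 n.
by have [] := s_ge0_lt n.+1.
Qed.

(** The form [r^2 - 13 r s + 26 s^2] is indefinite, so [a_n > 0] rests on
    [r_n s_n <= 0]; the other five terms are positive combinations of squares. *)
Lemma abcdet_positive n : positive_sextuple (abcdet n).
Proof.
have r2 : 0 < r_ n ^+ 2 by rewrite exprn_even_gt0 ?r_neq0.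
have s2 : 0 <= s_ n ^+ 2 by exact: sqr_ge0.
have rs := rs_le0 n.
by rewrite /positive_sextuple /= /a_ /b_ /c_ /d_ /e_ /t_; split; split; lia.
Qed.

Lemma s_inj : injective s_.
Proof.
have s_lt : {homo s_ : m n / (m < n)%N >-> m < n}.
  by apply: homo_ltn => [y x z|n]; [exact: lt_trans | have [] := s_ge0_lt n].
by move=> m n eq_s; case: (ltngtP m n) => // /s_lt; rewrite eq_s ltxx.
Qed.

(** Eliminating [r^2] between [b] and [c] isolates [s^2]. *)
Lemma abcdet_inj : injective abcdet.
Proof.
move=> m n [_ eq_b eq_c _ _ _]; apply: s_inj.
have elim_r k : 7 * b_ k - 6 * c_ k = 338 * s_ k ^+ 2 by rewrite /b_ /c_; ring.
have eq_s2 : s_ m ^+ 2 = s_ n ^+ 2.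
  by apply: (@mulfI _ (338 : int)) => //; rewrite -!elim_r eq_b eq_c.
have [[sm _] [sn _]] := (s_ge0_lt m, s_ge0_lt n).
by apply/eqP; rewrite -(@eqrXn2 _ 2) //; apply/eqP.
Qed.

(** * Infinitely many solutions of each sign *)

Lemma abcdet_solution n :
  primitive_positive_solutions ((-1) ^+ n.+1) (abcdet n).
Proof.
split; [exact: cubic_identity | exact: abcdet_positive |].
exact: gcd6_eq1_of_cubes (cubic_identity n).
Qed.

(** The sign in the cubic identity depends on the parity of [n]; [f] enumerates
    the indices of one parity. *)
Lemma infinite_solutions (k : int) (f : nat -> nat) :
  injective f -> (forall n, (-1) ^+ (f n).+1 = k) ->
  infinite_set (primitive_positive_solutions k `&` range abcdet).
Proof.
move=> f_inj sign_f.
apply: (@sub_infinite_set _ (range (abcdet \o f))).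
  move=> _ [n _ <-]; split; last by exists (f n).
  by rewrite -(sign_f n); exact: abcdet_solution.
move=> /(@finite_preimage _ _ _ (abcdet \o f)) fin.
apply: infinite_nat; apply: sub_finite_set (fin _) => [n _|m n _ _].
  by exists n.
by move=> /abcdet_inj /f_inj.
Qed.

Theorem theorem2p6 :
  (forall n : nat,
     gcdz (a_ n) (gcdz (b_ n) (gcdz (c_ n) (gcdz (d_ n) (gcdz (e_ n) (t_ n))))) = 1)
  /\ (forall n : nat,
        a_ n ^+ 3 + b_ n ^+ 3 + c_ n ^+ 3 + d_ n ^+ 3 + e_ n ^+ 3
        = t_ n ^+ 3 + (-1) ^+ n.+1)
  /\ infinite_set (primitive_positive_solutions 1 `&` range abcdet)
  /\ infinite_set (primitive_positive_solutions (-1) `&` range abcdet).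
Proof.
split; first by move=> n; exact: gcd6_eq1_of_cubes (cubic_identity n).
split; first exact: cubic_identity.
split.
  apply: (@infinite_solutions _ (fun n => n.*2.+1)) => [m n [/double_inj]//|n].
  by rewrite -signr_odd /= odd_double.
apply: (@infinite_solutions _ double) => [|n]; first exact: double_inj.
by rewrite -signr_odd /= odd_double.
Qed.
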